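(* Let $K\ge 4$, $L\ge 1$, $T\ge 1$ be integers. For $1\le i,j\le K$ let $\mathbf{H}_{ij}=\mathrm{diag}[h_{ij}^{(1)},\dots,h_{ij}^{(L)}]\otimes\mathbf{I}_T\in\mathbb{R}^{TL\times TL}$, where the joint distribution of the $LK^2$ real random variables $\{h_{ij}^{(\ell)}\}_{i,j=1,\dots,K,\ \ell=1,\dots,L}$ has a density in $\mathbb{R}^{LK^2}$ (fast fading if $T=1$, block fading with coherence period $T$ in general). Then, with probability $1$, the maximum total degrees of freedom achievable with vector space interference alignment strategies satisfies \[ \mathrm{DoF}\le\frac{K}{2}\left(1-2^{-17}\min\left\{\frac{1}{\sqrt[4]{L}},\ \frac{2^{(K-2)(K-3)/4}}{\sqrt{L}}\right\}\right). \]
   Context: $\otimes$ is the Kronecker product and $\mathbf{I}_T$ is the $T\times T$ identity, so $\mathbf{H}_{ij}$ is diagonal with each $h_{ij}^{(\ell)}$ repeated $T$ consecutive times. For a matrix $\mathbf{H}$ and a subspace $V$, $\mathbf{H}V=\{\mathbf{H}\mathbf{v}:\mathbf{v}\in V\}$; sums of subspaces are spans of unions. Given the channel matrices $\{\mathbf{H}_{ij}\}$, a vector space strategy with parameter $D$ (a nonnegative integer) is a choice of subspaces $V_1,\dots,V_K\subseteq\mathbb{R}^{TL}$, each of dimension $D$ ($V_i$ is the column span of the precoding matrix of transmitter $i$, which sends $D$ symbols; the subspaces may depend on the channel matrices). The decoding condition at receiver $i$ is \[ \mathbf{H}_{ii}V_i\cap\Bigl(\sum_{j\ne i}\mathbf{H}_{ij}V_j\Bigr)=\{0\}.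 \] The maximum sum (total) degrees of freedom is \[ \mathrm{DoF}=\max \frac{KD}{TL}, \] the maximum being over all $D$ and all $\{V_i\}$ with $\dim V_i=D$ that satisfy the decoding condition at every receiver $i=1,\dots,K$. *)

(* Defs.v *)
From HB Require Import structures.
From mathcomp Require Import all_boot all_order all_algebra.
From mathcomp.real_closed Require Import mxtens.
From mathcomp Require Import all_classical all_reals all_analysis.

Set Implicit Arguments.
Unset Strict Implicit.
Unset Printing Implicit Defensive.

Import Order.TTheory GRing.Theory Num.Theory.
Import numFieldNormedType.Exports.

Local Open Scope classical_set_scope.
Local Open Scope ring_scope.

Section lebesgue_tuple.
Context {R : realType}.
(* [R ^ n] is encoded as [n.-tuple], with its product sigma-algebra. *)
Local Notation Rn n := (n.-tuple (measurableTypeR R)).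

Definition cons_pair n (p : measurableTypeR R * Rn n) : Rn n.+1 :=
  [tuple of p.1 :: p.2].

Lemma measurable_cons_pair n : measurable_fun [set: _] (@cons_pair n).
Proof. exact: measurable_cons. Qed.

(* The [n.+1]-dimensional measure: the product of the one-dimensional Lebesgue
   measure with [m], transported along [cons_pair]. *)
Section lebesgue_cons.
Context (n : nat) (m : {sigma_finite_measure set Rn n -> \bar R}).

Definition lebesgue_cons : set (Rn n.+1) -> \bar R :=
  pushforward (lebesgue_measure \x m)%E (@cons_pair n).

Let lebesgue_cons0 : lebesgue_cons set0 = 0%E.
Proof. by rewrite /lebesgue_cons /pushforward preimage_set0 measure0. Qed.

Let lebesgue_cons_ge0 A : (0 <= lebesgue_cons A)%E.
Proof. by apply: integral_ge0. Qed.

Let mcons A : measurable A -> measurable (@cons_pair n @^-1` A).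
Proof.
by move=> mA; rewrite -[X in measurable X]setTI; exact: measurable_cons_pair.
Qed.

Let lebesgue_cons_sigma_additive : semi_sigma_additive lebesgue_cons.
Proof.
move=> F mF tF mUF; rewrite /lebesgue_cons /pushforward preimage_bigcup.
apply: measure_semi_sigma_additive.
- by move=> k; exact: mcons.
- apply/trivIsetP => /= i j _ _ ij; rewrite -preimage_setI.
  by move/trivIsetP : tF => /(_ _ _ _ _ ij) ->//; rewrite preimage_set0.
- by rewrite -preimage_bigcup; exact: mcons.
Qed.

HB.instance Definition _ := isMeasure.Build _ _ _ lebesgue_cons
  lebesgue_cons0 lebesgue_cons_ge0 lebesgue_cons_sigma_additive.

Let lebesgue_cons_sigma_finite : sigma_finite [set: Rn n.+1] lebesgue_cons.
Proof.
have /sigma_finiteP[F [TF ndF Foo]] := sigma_finiteT (@lebesgue_measure R).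
have /sigma_finiteP[G [TG ndG Goo]] := sigma_finiteT m.
pose uncons (t : Rn n.+1) : measurableTypeR R * Rn n :=
  (thead t, [tuple of behead t]).
have unconsK : cancel uncons (@cons_pair n).
  by move=> t; rewrite /cons_pair /uncons /= [RHS]tuple_eta.
have cons_pairK : cancel (@cons_pair n) uncons.
  by case=> x t; rewrite /uncons; congr pair; apply/val_inj.
have muncons : measurable_fun [set: Rn n.+1] uncons.
  apply: measurable_fun_pair; first exact: measurable_tnth.
  exact: measurable_behead.
exists (fun k => uncons @^-1` (F k `*` G k)).
  apply/esym; rewrite -preimage_bigcup.
  rewrite (_ : \bigcup_k _ = setT) ?preimage_setT//.
  apply/seteqP; split=> // -[x t] _.
  have [i _ Fx] : (\bigcup_k F k) x by rewrite -TF.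
  have [j _ Gt] : (\bigcup_k G k) t by rewrite -TG.
  exists (maxn i j) => //; split => /=.
    by move: x Fx; exact/subsetPset/ndF/leq_maxl.
  by move: t Gt; exact/subsetPset/ndG/leq_maxr.
move=> k; have [mF Fk] := Foo k; have [mG Gk] := Goo k; split.
  by rewrite -[X in measurable X]setTI; apply: muncons => //; exact: measurableX.
rewrite /lebesgue_cons /pushforward -comp_preimage.
rewrite (_ : uncons \o _ = id); last first.
  by apply/funext => p /=; rewrite cons_pairK.
by rewrite preimage_id product_measure1E// lte_mul_pinfty// ge0_fin_numE.
Qed.

HB.instance Definition _ := Measure_isSigmaFinite.Build _ _ _ lebesgue_cons
  lebesgue_cons_sigma_finite.

End lebesgue_cons.

Fixpoint lebesgue_tuple n : {sigma_finite_measure set Rn n -> \bar R} :=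
  if n is n'.+1 then lebesgue_cons (lebesgue_tuple n')
  else \d_([tuple] : Rn 0).

Lemma lebesgue_tuple_box n (A : 'I_n -> set (measurableTypeR R)) :
  (forall i, measurable (A i)) ->
  lebesgue_tuple n [set t | forall i, A i (tnth t i)] =
  (\prod_(i < n) lebesgue_measure (A i))%E.
Proof.
elim: n A => [|n IHn] A mA.
  rewrite big_ord0 /= diracE mem_set// => -[] //.
rewrite big_ord_recl -IHn//= -product_measure1E//; last first.
  rewrite (_ : [set _ | _] = \bigcap_(i in [set: 'I_n])
      ((fun t : Rn n => tnth t i) @^-1` A (lift ord0 i))).
    apply: fin_bigcap_measurable => // i _.
    by rewrite -[X in measurable X]setTI; exact: measurable_tnth.
  by apply/seteqP; split => t /= At i => [_|]; exact: At.
rewrite /lebesgue_cons /pushforward; congr (_ _).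
apply/seteqP; split => -[x t] /=.
  move=> H; split; first exact: (H ord0).
  by move=> i; have := H (lift ord0 i); rewrite tnthS.
move=> [Hx Ht] i; case: (unliftP ord0 i) => [j ->|-> //].
by rewrite tnthS; exact: Ht.
Qed.

Definition has_density n (mu : set (Rn n) -> \bar R) :=
  exists f : Rn n -> R,
    [/\ measurable_fun setT f, forall x, 0 <= f x &
        forall A, measurable A ->
          mu A = (\int[lebesgue_tuple n]_(x in A) (f x)%:E)%E].

End lebesgue_tuple.

Section random_vector.
Context d (Omega : measurableType d) (R : realType) (P : probability Omega R).
Context (I : finType) (X : I -> {RV P >-> R}).

(* The coordinates are listed in the order of [enum I]. *)
Definition random_vector (w : Omega) : #|I|.-tuple (measurableTypeR R) :=
  [tuple X (enum_val k) w | k < #|I|].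

Let measurable_random_vector : measurable_fun setT random_vector.
Proof.
apply/measurable_fun_tnthP => k.
rewrite (_ : _ \o _ = X (enum_val k)); first exact: (@measurable_funPT _ _ _ _ (X (enum_val k))).
by apply/funext => w /=; rewrite tnth_mktuple.
Qed.

HB.instance Definition _ := isMeasurableFun.Build _ _ _ _
  random_vector measurable_random_vector.

End random_vector.

Section interference_alignment.
Context {R : realType} {K N : nat}.
Implicit Types (H : 'I_K -> 'I_K -> 'M[R]_N) (V : 'I_K -> {vspace 'cV[R]_N}).

Definition mximg (A : 'M[R]_N) (V : {vspace 'cV[R]_N}) : {vspace 'cV[R]_N} :=
  (linfun (mulmx A) @: V)%VS.

Definition decodable H V (i : 'I_K) :=
  (mximg (H i i) (V i) :&: \sum_(j | j != i) mximg (H i j) (V j) = 0)%VS.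

(* [V i] is the column span of the precoding matrix of transmitter [i]. *)
Definition vs_strategy H (D : nat) V :=
  (forall i, \dim (V i) = D) /\ forall i, decodable H V i.

Definition achievable_dof H : set R :=
  [set x | exists D V, vs_strategy H D V /\ x = (K * D)%:R / N%:R].

(* By [DoF_max] below, this supremum is a maximum. *)
Definition DoF H : R := sup (achievable_dof H).

Lemma DoF_max H :
  achievable_dof H (DoF H) /\ ubound (achievable_dof H) (DoF H).
Proof.
pose ok D := `[< exists V, vs_strategy H D V >].
have ok0 : exists D, ok D.
  exists 0%N; apply/asboolP; exists (fun=> 0%VS); split=> i.
    exact: dimv0.
  by rewrite /decodable /mximg limg0 cap0v.
have [K0|K_gt0] := posnP K.
  have E : achievable_dof H = [set 0].
    apply/seteqP; split=> [x [D [V [_ ->]]]|x ->] /=.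
      by rewrite K0 mul0n mul0r.
    move: ok0 => [D /asboolP[V HV]]; exists D, V; split => //.
    by rewrite K0 mul0n mul0r.
  by rewrite /DoF E sup1; split => // x ->.
have okN D : ok D -> (D <= N)%N.
  move=> /asboolP[V [dimV _]]; rewrite -(dimV (Ordinal K_gt0)).
  by apply: leq_trans (dimvS (subvf _)) _; rewrite dimvf /dim /= muln1.
pose n := ex_maxn ok0 okN.
have [okn maxn] : ok n /\ forall D, ok D -> (D <= n)%N.
  by rewrite /n; case: ex_maxnP.
have in_n : achievable_dof H ((K * n)%:R / N%:R).
  by move/asboolP : okn => [V HV]; exists n, V.
have ub_n : ubound (achievable_dof H) ((K * n)%:R / N%:R).
  move=> x [D [V [HV ->]]]; rewrite ler_wpM2r ?invr_ge0// ler_nat leq_mul//.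
  by apply: maxn; apply/asboolP; exists V.
suff -> : DoF H = (K * n)%:R / N%:R by [].
apply/eqP; rewrite eq_le; apply/andP; split.
  by apply: ge_sup => //; exists ((K * n)%:R / N%:R).
by apply: ub_le_sup => //; exists ((K * n)%:R / N%:R).
Qed.

End interference_alignment.

(* [mxtens_index (l, t) = l * T + t], so each [g l] is repeated [T] consecutive
   times on the diagonal. *)
Definition channel_mx {R : realType} {L : nat} (T : nat) (g : 'I_L -> R) :
    'M[R]_(L * T) :=
  diag_mx (\row_l g l) *t 1%:M.

(* Main.v *)
Require Import Defs.
From HB Require Import structures.
From mathcomp Require Import all_boot all_order all_algebra.
From mathcomp.real_closed Require Import mxtens.
From mathcomp Require Import all_classical all_reals all_analysis measurable_realfun.
From mathcomp Require Import zify ring lra.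

Set Implicit Arguments.
Unset Strict Implicit.
Unset Printing Implicit Defensive.

Import Order.TTheory GRing.Theory Num.Theory.
Import numFieldNormedType.Exports.

Local Open Scope classical_set_scope.
Local Open Scope ring_scope.

(** Write N = TL. Decodability at a receiver confines all interfering spaces to
    a common space of dimension N - D, so any two of them are nearly aligned when
    D is close to N/2. Composing alignments along closed paths among four users
    makes V_1 nearly invariant under four diagonal matrices x_1, ..., x_4, the
    "loops", which are algebraically independent functions of the gains. Put
    B = {1, x_1, ..., x_4} and let V be the part of V_1 that receiver 3 sees
    inside the interference of transmitter 2. Plünnecke's inequality, in
    Petridis' form with dimensions for cardinalities, yields a nonzero X in V
    with dim (B^n X) <= (dim (B V) / dim V)^n dim X for all n. For generic gains
    and (s+1)^4 >= L, the monomials in the loops with exponents at most s span all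
    the matrices constant on blocks; hence B^(4s) X contains both H_11 X and a
    copy of X inside the interference at receiver 1. These meet trivially, so
    2 <= (dim (B V) / dim V)^(4s), and s of order L^(1/4) gives a gap of order
    L^(-1/4): the first term of the minimum is enough, for every K >= 4.
    Genericity is the nonvanishing of a determinant that is a nonzero polynomial
    in the gains, being a Vandermonde determinant for a suitable choice of them. *)

(** * Plünnecke's inequality for subspaces *)

Section Plunnecke.
Context {F : fieldType} {vT : vectType F}.
Implicit Types (B C : seq 'End(vT)) (X Y V : {vspace vT}).

Definition sumimg B X : {vspace vT} := (\sum_(b <- B) (b @: X))%VS.

Lemma sumimg_cons b B X : sumimg (b :: B) X = (b @: X + sumimg B X)%VS.
Proof. by rewrite /sumimg big_cons. Qed.

Lemma sumimg0 B : sumimg B 0 = 0%VS.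
Proof. by rewrite /sumimg big1 // => b _; rewrite limg0. Qed.

Lemma sumimgD B X Y : sumimg B (X + Y) = (sumimg B X + sumimg B Y)%VS.
Proof. by rewrite /sumimg -big_split; apply: eq_bigr => b _; rewrite limgD. Qed.

Lemma sumimgS B X Y : (X <= Y)%VS -> (sumimg B X <= sumimg B Y)%VS.
Proof. by move/addv_idPr <-; rewrite sumimgD addvSl. Qed.

Lemma sumimg_comm B c X :
  (forall b, b \in B -> (b \o c = c \o b)%VF) ->
  sumimg B (c @: X) = (c @: sumimg B X)%VS.
Proof.
move=> Bc; rewrite /sumimg limg_sum; apply: eq_big_seq => b bB.
by rewrite -!limg_comp Bc.
Qed.

Lemma mem_sumimg B b X v : b \in B -> v \in X -> b v \in sumimg B X.
Proof.
move=> bB vX; rewrite /sumimg (big_rem b) //=.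
by apply: (subvP (addvSl _ _)); apply: memv_img.
Qed.

(* Petridis' lemma with cardinalities replaced by dimensions: on a subspace
   where the expansion ratio of [B] is minimal, equal to [p / q], that ratio
   persists after any [C]. *)
Lemma sumimg_petridis B C X (p q : nat) :
    (forall Y, (Y <= X)%VS -> p * \dim Y <= q * \dim (sumimg B Y))%N ->
    (q * \dim (sumimg B X) <= p * \dim X)%N ->
    (forall c, c \in C -> injective c) ->
    (forall b c, b \in B -> c \in C -> (b \o c = c \o b)%VF) ->
  (q * \dim (sumimg B (sumimg C X)) <= p * \dim (sumimg C X))%N.
Proof.
move=> Xmin Xmax; elim: C => [|c C IHC] Cinj BC.
  by rewrite (_ : sumimg [::] X = 0%VS) ?sumimg0 ?dimv0 ?muln0 // /sumimg big_nil.
have tailP d : d \in C -> d \in c :: C by rewrite inE orbC => ->.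
have {}IHC := IHC (fun d dC => Cinj d (tailP d dC)) (fun b d bB dC => BC b d bB (tailP d dC)).
have ckerU U : (lker c :&: U = 0)%VS by have /lker0P/eqP -> := Cinj c (mem_head _ _); rewrite cap0v.
rewrite sumimg_cons sumimgD sumimg_comm; last by move=> b /BC; apply; exact: mem_head.
(* [Y] is the part of [X] that [c] maps into [S]. Adding [c @: X] raises dim [S] by at least dim [X]
   - dim [Y], and dim [sumimg B S] by at most dim [sumimg B X] - dim [sumimg B Y]; minimality on [Y]
   compares the two. *)
set S := sumimg C X in IHC *; pose Y := (X :&: c @^-1: S)%VS.
have YX : (Y <= X)%VS by exact: capvSl.
have cYS : (c @: Y <= S)%VS.
  by apply/subvP => _ /memv_imgP[y + ->]; rewrite memv_cap => /andP[_]; rewrite -memv_preim.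
have cXSY : (c @: X :&: S <= c @: Y)%VS.
  apply/subvP => v; rewrite memv_cap => /andP[/memv_imgP[x xX ->] xS].
  by apply: memv_img; rewrite memv_cap xX -memv_preim.
have dimc U : \dim (c @: U) = \dim U by rewrite limg_dim_eq // capvC.
have dX := dimv_sum_cap (c @: X) S; rewrite dimc in dX.
have dXY : (\dim (c @: X :&: S) <= \dim Y)%N by rewrite -(dimc Y) dimvS.
have dBX := dimv_sum_cap (c @: sumimg B X) (sumimg B S); rewrite dimc in dBX.
have dBY : (\dim (sumimg B Y) <= \dim (c @: sumimg B X :&: sumimg B S))%N.
  rewrite -(dimc (sumimg B Y)) dimvS // subv_cap limgS ?sumimgS //=.
  by rewrite -sumimg_comm ?sumimgS // => b /BC; apply; exact: mem_head.
have := Xmin Y YX; nia.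
Qed.

(** These products present B^n X as a single [sumimg], the form in which Petridis' lemma takes
    [C]. *)
Fixpoint words B n : seq 'End(vT) :=
  if n is n'.+1 then [seq (b \o c)%VF | b <- B, c <- words B n'] else [:: \1%VF].

Lemma sumimg_words B n X : sumimg (words B n) X = iter n (sumimg B) X.
Proof.
elim: n => [|n IHn]; first by rewrite /sumimg /= big_seq1 lim1g.
rewrite iterS -IHn /= /sumimg big_allpairs_dep; apply: eq_bigr => b _.
by rewrite limg_sum; apply: eq_bigr => c _; rewrite limg_comp.
Qed.

(* The linear Plünnecke inequality
   [dim (B^n X) / dim X <= (dim (B V) / dim V)^n]. *)
Lemma sumimg_plunnecke B V :
    (forall b, b \in B -> injective b) ->
    (forall b c, b \in B -> c \in B -> (b \o c = c \o b)%VF) ->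
    (0 < \dim V)%N ->
  exists2 X, (X <= V)%VS /\ (0 < \dim X)%N &
    forall n, (\dim (iter n (sumimg B) X) * \dim V ^ n <=
               \dim (sumimg B V) ^ n * \dim X)%N.
Proof.
move=> Binj Bcomm V0.
have [X [XV X0 Xmin]] : exists X, [/\ (X <= V)%VS, (0 < \dim X)%N &
    forall Y, (Y <= V)%VS -> (\dim (sumimg B X) * \dim Y <= \dim X * \dim (sumimg B Y))%N].
  (* The ratio depends only on two dimensions, which take finitely many values, so its minimum is
     attained. *)
  pose m := (\dim {:vT}).+1.
  have dimm (U : {vspace vT}) : (\dim U < m)%N by rewrite ltnS dimvS ?subvf.
  pose dims X : 'I_m * 'I_m := (Ordinal (dimm X), Ordinal (dimm (sumimg B X))).
  pose ok X := (X <= V)%VS && (0 < \dim X)%N.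
  pose ratio (x : 'I_m * 'I_m) : rat := x.2%:R / x.1%:R.
  have okV : `[< exists2 X, ok X & dims V = dims X >].
    by apply/asboolP; exists V => //; rewrite /ok subvv.
  case: (@Order.TotalTheory.arg_minP _ _ _ (dims V)
    (fun x => `[< exists2 X, ok X & x = dims X >]) ratio okV).
  move=> _ /asboolP[X /andP[XV X0] ->] Xmin; exists X; split=> // Y YV.
  have [->|Y0] := posnP (\dim Y); first by rewrite muln0.
  have /Xmin : `[< exists2 X, ok X & dims Y = dims X >].
    by apply/asboolP; exists Y => //; rewrite /ok YV.
  by rewrite /ratio /= ler_pdivrMr ?ltr0n // mulrAC ler_pdivlMr ?ltr0n //
     -!natrM ler_nat [X in (_ <= X)%N]mulnC.
have wordsP n : (forall c, c \in words B n -> injective c) /\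
    (forall b c, b \in B -> c \in words B n -> (b \o c = c \o b)%VF).
  elim: n => [|n [IHinj IHcomm]] /=.
    split=> [c|b c _]; rewrite inE => /eqP ->; last by rewrite comp_lfun1l comp_lfun1r.
    by move=> x y; rewrite !id_lfunE.
  split=> [_ /allpairsP[[b c] /= [bB cC ->]]|a _ aB /allpairsP[[b c] /= [bB cC ->]]].
    by move=> x y; rewrite !comp_lfunE => /(Binj _ bB)/(IHinj _ cC).
  by rewrite comp_lfunA (Bcomm a b) // -!comp_lfunA (IHcomm a c).
exists X => // n.
(* Petridis' lemma with [words B n] as [C]: each further [B] multiplies the dimension by at most dim
   (B X) / dim X. *)
have powX : (\dim (iter n (sumimg B) X) * \dim X ^ n <= \dim (sumimg B X) ^ n * \dim X)%N.
  elim: n => [|n IHn]; first by rewrite /= muln1 mul1n.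
  have [winj wcomm] := wordsP n.
  have := @sumimg_petridis B (words B n) X (\dim (sumimg B X)) (\dim X)
    (fun Y YX => Xmin Y (subv_trans YX XV)) (eq_leq (mulnC _ _)) winj wcomm.
  rewrite sumimg_words iterS !expnS; nia.
have ratioV : (\dim (sumimg B X) ^ n * \dim V ^ n <= \dim X ^ n * \dim (sumimg B V) ^ n)%N.
  case: n {powX} => [|n] //; by rewrite -!expnMn leq_exp2r // Xmin ?subvv.
have Xn0 : (0 < \dim X ^ n)%N by rewrite expn_gt0 X0.
rewrite -(leq_pmul2l Xn0); nia.
Qed.
End Plunnecke.

Section Iter.
Context {F : fieldType} {vT : vectType F}.
Implicit Types (B : seq 'End(vT)) (X Y V S U W : {vspace vT}).

Lemma sub_sumimg B X : \1%VF \in B -> (X <= sumimg B X)%VS.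
Proof. by move=> B1; apply/subvP => v /(mem_sumimg B1); rewrite id_lfunE. Qed.

Lemma sub_iter_sumimg B X m n :
  \1%VF \in B -> (m <= n)%N -> (iter m (sumimg B) X <= iter n (sumimg B) X)%VS.
Proof.
move=> B1; elim: n => [|n IHn]; first by rewrite leqn0 => /eqP ->.
rewrite leq_eqVlt => /predU1P[-> //|/IHn] /subv_trans; apply.
exact: sub_sumimg.
Qed.

(** Submodularity: what [U] adds to a space can only shrink when [W] grows to [S]. *)
Lemma dimv_add_link S U W D E :
    (W <= S)%VS -> (D <= \dim W)%N -> (\dim (W + U) <= E)%N ->
  (\dim (S + U) + D <= \dim S + E)%N.
Proof.
move=> WS DW WUE; rewrite (_ : (S + U = S + (W + U))%VS); last first.
  by rewrite addvA (addv_idPl WS).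
have := dimv_sum_cap S (W + U).
have : (\dim W <= \dim (S :&: (W + U)))%N by rewrite dimvS // subv_cap WS addvSl.
lia.
Qed.
End Iter.

Section Loops.
Context {A : nzRingType} {I : Type} (h : I -> I -> A) (i1 i2 i3 i4 : I).

(* The [k]-th entry of [loop_num] over that of [loop_den] is the product of
   channel gains around a closed path of alignments from transmitter 1 back to
   itself. The gains h43, h34, h32 and h13 each occur in a single loop. *)
Definition loop_num := [:: h i2 i3 * h i4 i1; h i2 i4 * h i3 i1;
                           h i3 i2 * h i4 i1; h i2 i3 * h i1 i4].
Definition loop_den := [:: h i2 i1 * h i4 i3; h i2 i1 * h i3 i4;
                           h i3 i1 * h i4 i2; h i1 i3 * h i2 i4].

End Loops.

(** * Alignment of four users *)

Section Channel.
Context {R : realType} {L T : nat}.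
Implicit Types (f g : 'I_L -> R).
Local Notation space := 'cV[R]_(L * T).

Definition act g : 'End(space) := linfun (mulmx (channel_mx T g)).

Lemma actE g (v : space) k j : act g v k j = g (mxtens_unindex k).1 * v k j.
Proof.
rewrite lfunE /= mxE (bigD1 k) //= big1 ?addr0 => [|i ik].
  by rewrite !mxE !eqxx !mulr1n mulr1.
rewrite !mxE; case: eqP => [e1|]; last by rewrite mulr0n !mul0r.
case: eqP => [e2|]; last by rewrite mulr0n mulr0 mul0r.
case/eqP: ik; apply: (can_inj (@mxtens_unindexK _ _)).
by rewrite [LHS]surjective_pairing [RHS]surjective_pairing e1 e2.
Qed.

Lemma act_comp f g : (act f \o act g)%VF = act (fun l => f l * g l).
Proof. by apply/lfunP => v; apply/matrixP => k j; rewrite comp_lfunE !actE mulrA. Qed.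

Lemma actC f g : (act f \o act g = act g \o act f)%VF.
Proof. by rewrite !act_comp; congr act; apply/funext => l; rewrite mulrC. Qed.

Lemma act1 : act (fun=> 1) = \1%VF.
Proof. by apply/lfunP => v; apply/matrixP => k j; rewrite actE id_lfunE mul1r. Qed.

Lemma act_inj g : (forall l, g l != 0) -> injective (act g).
Proof.
move=> g0 u v uv; apply/matrixP => k j; apply: (mulfI (g0 (mxtens_unindex k).1)).
by rewrite -!actE uv.
Qed.

Lemma limg_act_comp f g V : (act f @: (act g @: V) = act (fun l => f l * g l) @: V)%VS.
Proof. by rewrite -limg_comp act_comp. Qed.

Lemma dim_act g V : (forall l, g l != 0) -> \dim (act g @: V) = \dim V.
Proof.
by move=> /act_inj/lker0P/eqP g0; rewrite limg_dim_eq // g0 capv0.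
Qed.

Lemma act_prod_iter I (r : seq I) (x : I -> 'I_L -> R) (e : I -> nat)
    (B : seq 'End(space)) (X : {vspace space}) v :
    (forall k, act (x k) \in B) -> v \in X ->
  act (fun l => \prod_(k <- r) x k l ^+ e k) v
    \in iter (\sum_(k <- r) e k) (sumimg B) X.
Proof.
move=> xB vX; elim: r => [|k r IHr].
  rewrite big_nil (_ : (fun l => _) = fun=> 1) ?act1 ?id_lfunE //.
  by apply/funext => l; rewrite big_nil.
rewrite big_cons; set f := (fun l => _) in IHr.
rewrite (_ : (fun l => _) = fun l => x k l ^+ e k * f l); last first.
  by apply/funext => l; rewrite big_cons.
elim: (e k) => [|n IHn].
  by rewrite (_ : (fun l => _) = f) //; apply/funext => l; rewrite mul1r.
rewrite addSn iterS (_ : (fun l => _) = fun l => x k l * (x k l ^+ n * f l)).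
  by rewrite -act_comp comp_lfunE mem_sumimg.
by apply/funext => l; rewrite exprS mulrA.
Qed.

Section Strategy.
Context {K D : nat} (g : 'I_K -> 'I_K -> 'I_L -> R) (V : 'I_K -> {vspace space}).
Hypothesis g0 : forall i j l, g i j l != 0.
Hypothesis VD : vs_strategy (fun i j => channel_mx T (g i j)) D V.

(** The desired space at receiver [i] has dimension [D] and meets the interference trivially. *)
Lemma strategy_sum i :
  (\dim (\sum_(j | j != i) act (g i j) @: V j)%VS + D <= L * T)%N.
Proof.
have [dimV /(_ i)] := VD; rewrite /decodable /mximg => dec.
have := dimv_sum_cap (act (g i i) @: V i) (\sum_(j | j != i) act (g i j) @: V j).
rewrite dec dimv0 addn0 dim_act // dimV addnC => <-.
by apply: leq_trans (dimvS (subvf _)) _; rewrite dimvf /dim /= muln1.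
Qed.

Lemma strategy_half (i j : 'I_K) : j != i -> (2 * D <= L * T)%N.
Proof.
move=> ji; apply: leq_trans (strategy_sum i); rewrite mul2n -addnn leq_add2r.
rewrite -[X in (X <= _)%N](VD.1 j) -(dim_act (V j) (g0 i j)); apply: dimvS.
exact: (sumv_sup j).
Qed.

(** Both summands are images, under the same invertible diagonal a / g_ij, of interfering spaces at
    receiver [i]. *)
Lemma strategy_link i j k a b :
    j != i -> k != i -> (forall l, a l != 0) ->
    (forall l, a l * g i k l = b l * g i j l) ->
  (\dim (act a @: V j + act b @: V k)%VS <= L * T - D)%N.
Proof.
move=> ji ki a0 ab.
have c0 l : a l / g i j l != 0 by rewrite mulf_neq0 ?invr_eq0.
have E m d : (forall l, a l * g i m l = d l * g i j l) ->
    (act d @: V m = act (fun l => a l / g i j l) @: (act (g i m) @: V m))%VS.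
  move=> H; rewrite limg_act_comp; congr (act _ @: _)%VS; apply/funext => l.
  by rewrite mulrAC H mulfK.
rewrite (E j a) // (E k b) // -limgD dim_act //.
move: (strategy_sum i); rewrite addnC -leq_subRL; last first.
  by apply: leq_trans (strategy_sum i); rewrite leq_addl.
apply: leq_trans; apply: dimvS; rewrite subv_add.
by rewrite !(sumv_sup _ _ (subvv _)).
Qed.

Section FourUsers.
Variables i1 i2 i3 i4 : 'I_K.
Hypothesis i_uniq : uniq [:: i1; i2; i3; i4].

Definition loop (k : 'I_4) (l : 'I_L) : R :=
  let h i j := g i j l in (loop_num h i1 i2 i3 i4)`_k / (loop_den h i1 i2 i3 i4)`_k.

Lemma loop_neq0 k l : loop k l != 0.
Proof. by case: k => -[|[|[|[|]]]] // ?; rewrite !mulf_neq0 ?invr_eq0 ?mulf_neq0. Qed.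

(** The identity is included so that the iterates of [sumimg loops] increase. *)
Definition loops : seq 'End(space) := \1%VF :: [seq act (loop k) | k <- enum 'I_4].

Lemma loopsP b : b \in loops -> exists2 f, (forall l, f l != 0) & b = act f.
Proof.
rewrite inE => /predU1P[->|/mapP[k _ ->]].
  by exists (fun=> 1); rewrite ?act1 // => l; rewrite oner_eq0.
by exists (loop k) => // l; exact: loop_neq0.
Qed.

Let neqs : [/\ [/\ i1 != i2, i1 != i3 & i1 != i4], [/\ i2 != i1, i2 != i3 & i2 != i4],
  [/\ i3 != i1, i3 != i2 & i3 != i4] & [/\ i4 != i1, i4 != i2 & i4 != i3]].
Proof.
move: i_uniq; rewrite /= !inE !negb_or -!andbA andbT.
by case/and5P=> ? ? ? ? /andP[? ?]; do ! split; rewrite // eq_sym.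
Qed.

(** Start from V_1, of dimension D, and add eight spaces in turn: four intermediate stops and four
    loop images. Each is linked to a space already present, so it adds at most N - 2D, and D + 8(N -
    2D) = 8N - 15D. *)
Lemma dim_sumimg_loops : (\dim (sumimg loops (V i1)) + 15 * D <= 8 * (L * T))%N.
Proof.
have [dimV _] := VD; have [[n12 n13 n14] [n21 n23 n24] [n31 n32 n34] [n41 n42 n43]] := neqs.
have DN : (D <= L * T)%N by apply: leq_trans (strategy_sum i1); rewrite leq_addl.
have dimA f j : (forall l, f l != 0) -> (D <= \dim (act f @: V j))%N.
  by move=> f0; rewrite dim_act // dimV.
(* Multipliers at the intermediate stops. The paths between transmitters are 1-3-1 through receivers
   2, 4; 1-4-1 through 2, 3; 1-2-1 through 3, 4; and 1-3-4-1 through 2, 1, 2, which reuses the stop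
   [h23]. *)
pose h23 l := g i2 i3 l / g i2 i1 l; pose h24 l := g i2 i4 l / g i2 i1 l.
pose h32 l := g i3 i2 l / g i3 i1 l; pose h14 l := h23 l * g i1 i4 l / g i1 i3 l.
have h23_0 l : h23 l != 0 by rewrite mulf_neq0 ?invr_eq0.
have h24_0 l : h24 l != 0 by rewrite mulf_neq0 ?invr_eq0.
have h32_0 l : h32 l != 0 by rewrite mulf_neq0 ?invr_eq0.
have h14_0 l : h14 l != 0 by rewrite !mulf_neq0 ?invr_eq0.
pose o k (lt : (k < 4)%N) := loop (Ordinal lt).
pose A0 := (act (fun=> 1) @: V i1)%VS.
pose A1 := (A0 + act h23 @: V i3)%VS; pose A2 := (A1 + act (o 0%N isT) @: V i1)%VS.
pose A3 := (A2 + act h24 @: V i4)%VS; pose A4 := (A3 + act (o 1%N isT) @: V i1)%VS.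
pose A5 := (A4 + act h32 @: V i2)%VS; pose A6 := (A5 + act (o 2%N isT) @: V i1)%VS.
pose A7 := (A6 + act h14 @: V i4)%VS; pose A8 := (A7 + act (o 3%N isT) @: V i1)%VS.
have sub U W X : (U <= W)%VS -> (U <= W + X)%VS by move/subv_trans; apply; exact: addvSl.
have link i j k a b S : j != i -> k != i -> (forall l, a l != 0) ->
    (forall l, a l * g i k l = b l * g i j l) -> (act a @: V j <= S)%VS ->
    (\dim (S + act b @: V k) + D <= \dim S + (L * T - D))%N.
  move=> ji ki a0 ab aS; apply: dimv_add_link aS (dimA _ _ a0) _.
  exact: (strategy_link (i := i)).
have d0 : \dim A0 = D by rewrite dim_act.
have d1 : (\dim A1 + D <= \dim A0 + (L * T - D))%N.
  apply: (link i2 i1 i3 (fun=> 1)) => // l; by rewrite mul1r /h23 mulfVK.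
have d2 : (\dim A2 + D <= \dim A1 + (L * T - D))%N.
  apply: (link i4 i3 i1 h23) => //; last by exact: addvSr.
  move=> l; rewrite /o /loop /h23 /=; field; by rewrite ?g0.
have d3 : (\dim A3 + D <= \dim A2 + (L * T - D))%N.
  apply: (link i2 i1 i4 (fun=> 1)) => //; last by rewrite !sub.
  by move=> l; rewrite mul1r /h24 mulfVK.
have d4 : (\dim A4 + D <= \dim A3 + (L * T - D))%N.
  apply: (link i3 i4 i1 h24) => //; last by exact: addvSr.
  move=> l; rewrite /o /loop /h24 /=; field; by rewrite ?g0.
have d5 : (\dim A5 + D <= \dim A4 + (L * T - D))%N.
  apply: (link i3 i1 i2 (fun=> 1)) => //; last by rewrite !sub.
  by move=> l; rewrite mul1r /h32 mulfVK.
have d6 : (\dim A6 + D <= \dim A5 + (L * T - D))%N.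
  apply: (link i4 i2 i1 h32) => //; last by exact: addvSr.
  move=> l; rewrite /o /loop /h32 /=; field; by rewrite ?g0.
have d7 : (\dim A7 + D <= \dim A6 + (L * T - D))%N.
  apply: (link i1 i3 i4 h23) => //; last by do 5!apply/sub; exact: addvSr.
  by move=> l; rewrite /h14 mulfVK.
have d8 : (\dim A8 + D <= \dim A7 + (L * T - D))%N.
  apply: (link i2 i4 i1 h14) => //; last by exact: addvSr.
  move=> l; rewrite /o /loop /h14 /h23 /=; field; by rewrite ?g0.
have le8 : (\dim (sumimg loops (V i1)) <= \dim A8)%N.
  apply: dimvS; rewrite /sumimg big_cons big_map /= -act1.
  rewrite subv_add; apply/andP; split; first by rewrite !sub.
  elim/big_ind: _ => [|U W UA WA|k _]; first exact: sub0v.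
    by rewrite subv_add UA.
  have lastA U (W : {vspace space}) : (W <= U + W)%VS by exact: addvSr.
  case: k => -[|[|[|[|//]]]] k4.
  - by do 6!apply/sub; rewrite (bool_irrelevance k4 isT) lastA.
  - by do 4!apply/sub; rewrite (bool_irrelevance k4 isT) lastA.
  - by do 2!apply/sub; rewrite (bool_irrelevance k4 isT) lastA.
  - by rewrite (bool_irrelevance k4 isT) lastA.
move: DN d0 d1 d2 d3 d4 d5 d6 d7 d8 le8.
move: (\dim A0) (\dim A1) (\dim A2) (\dim A3) (\dim A4) (\dim A5) (\dim A6) (\dim A7)
  (\dim A8) (\dim (sumimg _ _)) => a0 a1 a2 a3 a4 a5 a6 a7 a8 a9.
by move: (L * T)%N => N; clear; lia.
Qed.

Definition aligned : {vspace space} :=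
  (V i1 :&: act (fun l => g i3 i2 l / g i3 i1 l) @: V i2)%VS.

(** Two spaces of dimension D with a sum of dimension at most N - D share at least 3D - N. *)
Lemma dim_aligned : (3 * D <= \dim aligned + L * T)%N.
Proof.
have [dimV _] := VD; have [[n12 n13 n14] [n21 n23 n24] [n31 n32 n34] [n41 n42 n43]] := neqs.
pose h32 l := g i3 i2 l / g i3 i1 l.
have DN : (D <= L * T)%N by apply: leq_trans (strategy_sum i1); rewrite leq_addl.
have : (\dim (act (fun=> 1) @: V i1 + act h32 @: V i2)%VS <= L * T - D)%N.
  by apply: (strategy_link (i := i3)) => // l; rewrite mul1r /h32 mulfVK.
rewrite act1 lim1g; have := dimv_sum_cap (V i1) (act h32 @: V i2).
rewrite dim_act ?(dimV i1) ?(dimV i2) => [|l]; last by rewrite mulf_neq0 ?invr_eq0.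
rewrite -/aligned => e1 e2; move: DN e1 e2.
move: (\dim (V i1 + _)%VS) (\dim aligned) => p q; move: (L * T)%N => N; clear; lia.
Qed.

(** Plünnecke's inequality bounds the growth of some [X] inside [aligned], whereas spanning by
    monomials of degree at most 4s forces its dimension to double. *)
Lemma strategy_bound s (J : finType) (e : J -> 'I_4 -> nat) :
    (forall j k, e j k <= s)%N ->
    (forall f : 'I_L -> R, exists c : J -> R,
      forall l, f l = \sum_j c j * \prod_(k < 4) loop k l ^+ e j k) ->
    (L * T < 3 * D)%N ->
  (2 * (3 * D - L * T) ^ (4 * s) <= (8 * (L * T) - 15 * D) ^ (4 * s))%N.
Proof.
move=> es span ND; have [dimV decV] := VD.
have [[n12 n13 n14] [n21 n23 n24] [n31 n32 n34] [n41 n42 n43]] := neqs.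
have al0 : (0 < \dim aligned)%N.
  move: dim_aligned ND; move: (\dim _) => p; move: (L * T)%N => N; clear; lia.
have loops_inj b : b \in loops -> injective b.
  by case/loopsP => f f0 ->; exact: act_inj.
have loops_comm b c : b \in loops -> c \in loops -> (b \o c = c \o b)%VF.
  by case/loopsP => f _ -> /loopsP[f' _ ->]; exact: actC.
have [X [XV X0] /(_ (4 * s)%N) growth] := sumimg_plunnecke loops_inj loops_comm al0.
set U := iter _ _ X in growth.
have actU f v : v \in X -> act f v \in U.
  move=> vX; have [c fE] := span f.
  have -> : act f v = \sum_j c j *: act (fun l => \prod_(k < 4) loop k l ^+ e j k) v.
    apply/matrixP => i k; rewrite actE fE mulr_suml summxE.
    by apply: eq_bigr => j _; rewrite mxE actE mulrA.
  apply: memv_suml => j _; apply: memvZ.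
  apply: (subvP (sub_iter_sumimg X (mem_head _ _) _)); last first.
    apply: act_prod_iter => // k; rewrite inE; apply/orP; right.
    by apply: map_f; rewrite mem_enum.
  by rewrite !big_ord_recl big_ord0 /= !mulSn mul0n !addn0 !leq_add.
have subU f : (act f @: X <= U)%VS.
  by apply/subvP => _ /memv_imgP[v vX ->]; exact: actU.
(* [act a] sends [X] into the desired space at receiver 1. [b] cancels the factor h32 / h31 of
   [aligned] and applies h12, so [act b] sends [X] into the interference there. *)
pose a := g i1 i1; pose b l := g i1 i2 l * (g i3 i1 l / g i3 i2 l).
have a0 l : a l != 0 by exact: g0.
have b0 l : b l != 0 by rewrite !mulf_neq0 ?invr_eq0.
have disj : (act a @: X :&: act b @: X = 0)%VS.
  apply/eqP; rewrite -subv0 -[X in (_ <= X)%VS](decV i1) /mximg.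
  apply: capvS.
    apply: limgS; apply: subv_trans XV _; exact: capvSl.
  apply: (sumv_sup i2); first by rewrite eq_sym.
  rewrite -/(act _) -limg_act_comp; apply: limgS.
  apply: subv_trans (limgS _ (subv_trans XV (capvSr _ _))) _.
  rewrite limg_act_comp (_ : (fun l => _) = fun=> 1) ?act1 ?lim1g //.
  by apply/funext => l; field; rewrite !g0.
have dimU : (2 * \dim X <= \dim U)%N.
  have := dimv_sum_cap (act a @: X) (act b @: X).
  rewrite disj dimv0 addn0 !dim_act // mul2n -addnn => <-.
  by apply: dimvS; rewrite subv_add !subU.
have le_al : (3 * D - L * T <= \dim aligned)%N by rewrite leq_subLR addnC dim_aligned.
have le_B : (\dim (sumimg loops aligned) <= 8 * (L * T) - 15 * D)%N.
  have : (\dim (sumimg loops aligned) <= \dim (sumimg loops (V i1)))%N.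
    by rewrite dimvS // sumimgS // capvSl.
  move/leq_trans; apply; have := dim_sumimg_loops.
  by move: (\dim _) => p; move: (L * T)%N => N; clear; lia.
(* For [s] equal to 0, [U] is [X], and doubling contradicts [X0]. *)
have [s0|s0] := posnP s.
  rewrite /U s0 /= in dimU; move: dimU X0; move: (\dim _) => p; clear; lia.
have : ((3 * D - L * T) ^ (4 * s) <= \dim aligned ^ (4 * s))%N by rewrite leq_exp2r ?muln_gt0.
have : (\dim (sumimg loops aligned) ^ (4 * s) <= (8 * (L * T) - 15 * D) ^ (4 * s))%N.
  by rewrite leq_exp2r ?muln_gt0.
move=> leB leA; rewrite -(leq_pmul2r X0).
apply: leq_trans (leq_mul leB (leqnn _)); apply: leq_trans growth.
by rewrite mulnAC leq_mul.
Qed.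

End FourUsers.
End Strategy.

End Channel.

(** * From dimension growth to degrees of freedom *)

(** Induction by (1 + u)(1 - (n + 1)u) <= 1 - nu. *)
Lemma expr_1D_mul_le1 (R : realFieldType) (u : R) n :
  0 <= u -> (1 + u) ^+ n * (1 - n%:R * u) <= 1.
Proof.
move=> u0; elim: n => [|n IHn]; first by rewrite expr0 mul0r subr0 mulr1.
apply: le_trans IHn; rewrite exprSr -mulrA ler_wpM2l //.
  by rewrite exprn_ge0 // addr_ge0.
rewrite -natr1; have : 0 <= n%:R * u ^+ 2 by rewrite mulr_ge0 // sqr_ge0.
have := sqr_ge0 u; nra.
Qed.

Lemma root4_ge (R : realType) (L s : nat) :
  (s ^ 4 <= L)%N -> s%:R <= L%:R `^ (4^-1) :> R.
Proof.
move=> sL; rewrite (_ : s%:R = (s ^ 4)%:R `^ (4^-1)); last first.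
  by rewrite natrX -powR_mulrn // -powRrM divff // powRr1.
by rewrite ge0_ler_powR ?nnegrE ?ler_nat // invr_ge0.
Qed.

(** Put eta = 2^-17 / [la]. Were the bound false, N - 2D < eta N would give (8N - 15D) / (3D - N) <=
    1 + 36 eta. The 4s-th power of this is below 2, since 144 s eta <= 144 / 2^17 < 1/4. *)
Lemma dof_ratio_le (R : realFieldType) (N D s : nat) (la : R) :
    (0 < N)%N -> (2 * D <= N)%N -> 1 <= la -> s%:R <= la ->
    ((N < 3 * D)%N ->
      (2 * (3 * D - N) ^ (4 * s) <= (8 * N - 15 * D) ^ (4 * s))%N) ->
  D%:R / N%:R <= 2^-1 * (1 - 2 ^- 17 / la) :> R.
Proof.
have v0 : 0 < 2 ^- 17 :> R by rewrite invr_gt0 exprn_gt0.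
have v1 : 1000 * 2 ^- 17 < 1 :> R.
  have v17 : 0 < 2 ^+ 17 :> R by apply: exprn_gt0; exact: ltr0Sn.
  rewrite (ltr_pdivrMr _ _ v17) mul1r !exprS expr0 mulr1; clear; lra.
move=> N0 DN la1 sla bound; rewrite leNgt; apply/negP => dof.
have la0 : 0 < la by exact: lt_le_trans ltr01 la1.
have NR : 0 < N%:R :> R by rewrite ltr0n.
have DNR : 2 * D%:R <= N%:R :> R by rewrite -natrM ler_nat.
rewrite ltr_pdivlMr // in dof.
move: (2 ^- 17) v0 v1 dof => v v0 v1 dof; pose eta := v / la; rewrite -/eta in dof.

have eta0 : 0 < eta by rewrite divr_gt0.
have eta_la : eta * la = v by rewrite mulfVK // gt_eqF.
have eta_v : eta <= v by rewrite ler_pdivrMr // ler_peMr // ltW.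
have s_eta : s%:R * eta <= v by rewrite -eta_la mulrC ler_pM2l.
have etaN : eta * N%:R <= v * N%:R by rewrite ler_pM2r.
have vN : 1000 * v * N%:R < N%:R by rewrite gtr_pMl.
have dof' : N%:R - eta * N%:R < 2 * D%:R by lra.
have ND : (N < 3 * D)%N by rewrite -(ltr_nat R) natrM; lra.
have := bound ND; rewrite -(ler_nat R) natrM !natrX.
rewrite (natrB _ (ltnW ND)) natrB ?natrM; last first.
  by apply: leq_trans (_ : 8 * (2 * D) <= _)%N; [rewrite mulnA leq_mul2r orbT|rewrite leq_mul2l].
set a := 3%:R * _ - _; set b := 8%:R * _ - _ => two_le.
have aN : N%:R <= 4 * a by rewrite /a; lra.
have a0 : 0 < a by lra.
have b0 : 0 <= b by rewrite /b; lra.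
have eta_a : eta * N%:R <= eta * (4 * a) by rewrite ler_pM2l.
(* Here b - a = 9(N - 2D) < 9 eta N, and N <= 4a. *)
have ba : b <= (1 + 36 * eta) * a by rewrite /b /a in aN eta_a *; lra.
have eta36 : 0 <= 36 * eta by rewrite mulr_ge0 // ltW.
have := expr_1D_mul_le1 (4 * s) eta36; set p := _ ^+ _ => p_le1.
have p2 : 2 <= p.
  rewrite -(ler_pM2r (exprn_gt0 (4 * s) a0)); apply: le_trans two_le _.
  by rewrite /p -exprMn lerXn2r ?nnegrE // (le_trans b0).
have : p * (3 / 4) <= 1.
  apply: le_trans p_le1; apply: ler_wpM2l; first by lra.
  rewrite natrM; lra.
lra.
Qed.

(** * Zero sets of polynomials *)

(** Iterated univariate polynomials: the outermost indeterminate is the first coordinate, matching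
    the recursion of [lebesgue_tuple]. *)
Fixpoint mvpoly (A : idomainType) n : idomainType :=
  if n is n'.+1 then {poly (mvpoly A n')} else A.

Fixpoint mvconst (A : idomainType) n : {rmorphism A -> mvpoly A n} :=
  if n is n'.+1 then (polyC \o mvconst A n' : {rmorphism A -> mvpoly A n'.+1})
  else (idfun : {rmorphism A -> mvpoly A 0}).

Fixpoint mveval (A : idomainType) n : n.-tuple A -> {rmorphism mvpoly A n -> A} :=
  if n is n'.+1 then fun t =>
    (mveval [tuple of behead t] \o horner_eval (mvconst A n' (thead t))
       : {rmorphism mvpoly A n'.+1 -> A})
  else fun=> (idfun : {rmorphism mvpoly A 0 -> A}).

Fixpoint mvvar (A : idomainType) n : nat -> mvpoly A n :=
  if n is n'.+1 then fun k => if k is k'.+1 then (mvvar A n' k')%:P else 'X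
  else fun=> 0.

Lemma mvconst_inj (A : idomainType) n : injective (mvconst A n).
Proof. by elim: n => [|n IHn] //= x y /polyC_inj/IHn. Qed.

Lemma mvevalS (A : idomainType) n (t : n.+1.-tuple A) (p : mvpoly A n.+1) :
  mveval t p = mveval [tuple of behead t] p.[mvconst A n (thead t)].
Proof. by []. Qed.

Lemma mveval_const (A : idomainType) n (t : n.-tuple A) c : mveval t (mvconst A n c) = c.
Proof. by elim: n t => [|n IHn] //= t; rewrite /horner_eval hornerC IHn. Qed.

Lemma mveval_var (A : idomainType) n (t : n.-tuple A) (k : 'I_n) :
  mveval t (mvvar A n k) = tnth t k.
Proof.
elim: n t k => [|n IHn] t k; first by case: k.
rewrite mvevalS; case: (unliftP ord0 k) => [j ->|-> /=].
  by rewrite (tuple_eta t) tnthS /= hornerC IHn; congr (tnth _ _); apply: val_inj.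
by rewrite hornerX mveval_const.
Qed.

Section Null.
Context {R : realType}.

Lemma measurable_mveval n (p : mvpoly R n) :
  measurable_fun setT (fun t : n.-tuple (measurableTypeR R) => mveval t p : measurableTypeR R).
Proof.
elim: n p => [|n IHn] p; first exact: measurable_cst.
rewrite (_ : (fun t => _) = fun t : n.+1.-tuple (measurableTypeR R) =>
   \sum_(i < size p) mveval [tuple of behead t] p`_i * thead t ^+ i); last first.
  apply/funext => t; rewrite mvevalS horner_coef rmorph_sum /=; apply: eq_bigr => i _.
  by rewrite rmorphM rmorphXn mveval_const.
apply: measurable_sum => i; apply: measurable_funM.
  by apply: measurableT_comp (IHn _) _; exact: measurable_behead.
by apply: measurable_funX; exact: measurable_tnth.
Qed.

Lemma mveval_zero_measurable n (p : mvpoly R n) :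
  measurable [set t : n.-tuple (measurableTypeR R) | mveval t p = 0].
Proof.
rewrite (_ : [set t | _] = setT `&` (fun t : n.-tuple (measurableTypeR R) =>
  mveval t p : measurableTypeR R) @^-1` [set 0]).
  by apply: measurable_mveval => //; exact: measurable_set1.
by rewrite setTI.
Qed.

(** Induction with Fubini: outside the finitely many roots of [p] among the constants, fixing the
    first coordinate leaves a nonzero polynomial in the others. *)
Lemma mveval_null n (p : mvpoly R n) : p != 0 ->
  lebesgue_tuple n [set t : n.-tuple (measurableTypeR R) | mveval t p = 0] = 0%E.
Proof.
elim: n p => [|n IHn] p p0.
  by rewrite /= diracE memNset //=; apply/eqP.
pose Z : set (n.+1.-tuple (measurableTypeR R)) := [set t | mveval t p = 0].
have mZ : measurable Z by exact: mveval_zero_measurable.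
rewrite /= /lebesgue_cons /pushforward -/Z /product_measure1.
set B := _ @^-1` _.
have mB : measurable B.
  by rewrite -[X in measurable X]setTI; exact: measurable_cons_pair.
pose roots := [set x : R | root p (mvconst R n x)].
have finroots : finite_set roots.
  apply: contrapT => /(@infinite_set_fset _ _ (size p))[rs rsp].
  rewrite leqNgt => /negP; apply.
  rewrite -(size_map (mvconst R n)); apply: max_poly_roots => //.
    by apply/allP => _ /mapP[x xrs ->]; exact: rsp xrs.
  by rewrite (map_inj_uniq (@mvconst_inj _ n)) finmap.fset_uniq.
rewrite (@ge0_ae_eq_integral _ _ _ _ _ _ (cst 0%E)) ?integral0 //.
- exact: measurable_fun_xsection.
exists roots; split.
- exact: countable_measurable (finite_set_countable finroots).
- exact: countable_lebesgue_measure0 (finite_set_countable finroots).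
move=> x /=; apply: contra_notP => xroot _.
rewrite -[RHS](IHn p.[mvconst R n x]) //; last exact/negP.
have evalx t : mveval (cons_pair (x, t)) p = mveval t p.[mvconst R n x].
  by rewrite mvevalS; congr (mveval _ _); exact: val_inj.
congr (lebesgue_tuple n _); apply/seteqP; split=> t.
  by rewrite /xsection /= inE /B /Z /preimage /mkset evalx.
by rewrite /xsection /= inE /B /Z /preimage /mkset evalx.
Qed.
End Null.

(** * Generic gains *)

Definition digit (b j k : nat) : nat := ((j %/ b ^ k) %% b)%N.

Lemma digit_le s j k : (digit s.+1 j k <= s)%N.
Proof. by rewrite -ltnS ltn_pmod. Qed.

Lemma sum_digit (b j m : nat) : (0 < b)%N -> (j < b ^ m)%N ->
  (\sum_(k < m) digit b j k * b ^ k = j)%N.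
Proof.
move=> b0; elim: m j => [|m IHm] j jb.
  by rewrite big_ord0; case: j jb.
rewrite big_ord_recl /digit /= expn0 divn1 muln1 [RHS](divn_eq j b) addnC; congr addn.
rewrite -[in RHS](IHm (j %/ b)%N) ?ltn_divLR -?expnSr // big_distrl /=.
by apply: eq_bigr => k _; rewrite /digit /bump /= add1n expnS divnMA -mulnA [(b * _)%N]mulnC.
Qed.

Section LoopMatrix.
Context {A : comNzRingType} {I : Type} {L : nat} (h : 'I_L -> I -> I -> A).
Variables (i1 i2 i3 i4 : I) (s : nat).

(* The monomials in the loops with exponents at most [s], cleared of
   denominators; the exponents of row [j] are the digits of [j] in base [s.+1]. *)
Definition loop_mx : 'M[A]_L := \matrix_(j, l) \prod_(k < 4)
  ((loop_num (h l) i1 i2 i3 i4)`_k ^+ digit s.+1 j k *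
   (loop_den (h l) i1 i2 i3 i4)`_k ^+ (s - digit s.+1 j k)).

End LoopMatrix.

Lemma map_loop_mx (A A' : comNzRingType) (f : {rmorphism A -> A'}) (I : Type) (L : nat)
    (h : 'I_L -> I -> I -> A) i1 i2 i3 i4 s :
  map_mx f (loop_mx h i1 i2 i3 i4 s) = loop_mx (fun l i j => f (h l i j)) i1 i2 i3 i4 s.
Proof.
apply/matrixP => j l; rewrite !mxE rmorph_prod /=; apply: eq_bigr => k _.
rewrite rmorphM !rmorphXn; congr (_ ^+ _ * _ ^+ _);
  by case: k => -[|[|[|[|//]]]] k4 /=; rewrite rmorphM.
Qed.

Section LoopMatrixReal.
Context {R : realType} {K L : nat} (g : 'I_K -> 'I_K -> 'I_L -> R).
Variables (i1 i2 i3 i4 : 'I_K) (s : nat).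
Hypothesis g0 : forall i j l, g i j l != 0.

Let den (l : 'I_L) : R :=
  \prod_(k < 4) (loop_den (fun i j => g i j l) i1 i2 i3 i4)`_k ^+ s.

Lemma den_neq0 l : den l != 0.
Proof.
apply/prodf_neq0 => k _; apply: expf_neq0.
by case: k => -[|[|[|[|]]]] // ?; rewrite mulf_neq0.
Qed.

Lemma loop_mxE j l : loop_mx (fun l i j => g i j l) i1 i2 i3 i4 s j l =
  (\prod_(k < 4) loop g i1 i2 i3 i4 k l ^+ digit s.+1 j k) * den l.
Proof.
rewrite mxE -big_split /=; apply: eq_bigr => k _; rewrite /loop expr_div_n.
have d0 : (loop_den (fun i j => g i j l) i1 i2 i3 i4)`_k != 0.
  by case: k => -[|[|[|[|]]]] // ?; rewrite mulf_neq0.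
rewrite -mulrA; congr (_ * _); have dk0 := expf_neq0 (digit s.+1 j k) d0.
by apply: (mulfI dk0); rewrite mulVKf // -exprD subnKC // digit_le.
Qed.

(** Column [l] holds the values of the monomials at [l], scaled by the nonzero [den l]; inverting
    the matrix gives the coefficients. *)
Lemma loop_mx_span : \det (loop_mx (fun l i j => g i j l) i1 i2 i3 i4 s) != 0 ->
  forall f : 'I_L -> R, exists c : 'I_L -> R, forall l,
    f l = \sum_j c j * \prod_(k < 4) loop g i1 i2 i3 i4 k l ^+ digit s.+1 j k.
Proof.
rewrite -unitfE -unitmxE; set M := loop_mx _ _ _ _ _ _ => uM f.
pose r := \row_l (f l * den l); exists (fun j => (r *m invmx M) 0 j) => l.
apply: (mulIf (den_neq0 l)); transitivity (r 0 l); first by rewrite mxE.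
rewrite -[in LHS](mulmxKV uM r) mxE mulr_suml.
by apply: eq_bigr => j _; rewrite /M loop_mxE mulrA.
Qed.

End LoopMatrixReal.

Section Witness.
Context {R : realType} {K L : nat}.
Variables (i1 i2 i3 i4 : 'I_K) (s : nat).
Hypothesis i_uniq : uniq [:: i1; i2; i3; i4].
Hypothesis sL : (L <= s.+1 ^ 4)%N.

(* With these gains the [k]-th loop is [l.+1 ^ (s.+1 ^ k)], so that row [j] of
   the matrix of monomials is [l.+1 ^ j]: a Vandermonde matrix. *)
Definition witness (i j : 'I_K) (l : 'I_L) : R :=
  if (i, j) == (i4, i3) then (l.+1%:R ^+ (s.+1 ^ 0))^-1
  else if (i, j) == (i3, i4) then (l.+1%:R ^+ (s.+1 ^ 1))^-1
  else if (i, j) == (i3, i2) then l.+1%:R ^+ (s.+1 ^ 2)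
  else if (i, j) == (i1, i3) then (l.+1%:R ^+ (s.+1 ^ 3))^-1
  else 1.

Lemma witness_neq0 i j l : witness i j l != 0.
Proof.
by rewrite /witness; do ! case: ifP => _;
   rewrite ?invr_eq0 ?expf_neq0 ?oner_neq0 ?pnatr_eq0.
Qed.

Lemma loop_witness k l :
  loop witness i1 i2 i3 i4 k l = l.+1%:R ^+ (s.+1 ^ k).
Proof.
have := i_uniq; rewrite /= !inE !negb_or -!andbA andbT.
case/and5P => n12 n13 n14 n23 /andP[n24 n34].
have E (a b : 'I_K) : a != b -> ((a == b) = false) * ((b == a) = false) :> Type.
  by move=> /negbTE ab; split=> //; rewrite eq_sym.
pose Es := (E i1 i2 n12, E i1 i3 n13, E i1 i4 n14, E i2 i3 n23, E i2 i4 n24, E i3 i4 n34).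
case: k => -[|[|[|[|//]]]] k4; rewrite /loop /witness /= !xpair_eqE ?eqxx ?Es /=.
all: by rewrite ?mulr1 ?mul1r ?divr1 ?invrK ?expn0.
Qed.

Lemma det_loop_mx_witness :
  \det (loop_mx (fun l i j => witness i j l) i1 i2 i3 i4 s) != 0.
Proof.
pose a : 'rV[R]_L := \row_l l.+1%:R.
pose d : 'rV[R]_L := \row_l
  \prod_(k < 4) (loop_den (fun i j => witness i j l) i1 i2 i3 i4)`_k ^+ s.
rewrite (_ : loop_mx _ _ _ _ _ _ = Vandermonde L a *m diag_mx d); last first.
  apply/matrixP => j l; rewrite mul_mx_diag loop_mxE; last exact: witness_neq0.
  rewrite !mxE; congr (_ * _).
  under eq_bigr do rewrite loop_witness -exprM mulnC.
  (* By [sL], four digits in base [s.+1] represent every row index, so the exponents add up to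
     [j]. *)
  by rewrite -expr_sum sum_digit // (leq_trans (ltn_ord j)).
rewrite det_mulmx det_diag det_Vandermonde mulf_neq0 //; last first.
  by apply/prodf_neq0 => l _; rewrite mxE den_neq0 //; exact: witness_neq0.
apply/prodf_neq0 => i _; apply/prodf_neq0 => j ij; rewrite !mxE.
by rewrite subr_eq0 eqr_nat eqSS neq_ltn ij orbT.
Qed.
End Witness.

(** * The almost sure bound *)

(** The zero set of [p] is Lebesgue null, hence null for any law with a density. *)
Lemma ae_mveval_neq0 (R : realType) d (Omega : measurableType d) (P : probability Omega R)
    (I : finType) (X : I -> {RV P >-> R}) (p : mvpoly R #|I|) :
    has_density (distribution P (random_vector X)) -> p != 0 ->
  {ae P, forall w, mveval (random_vector X w) p != 0}.
Proof.
move=> [f [mf f0 fE]] p0.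
pose Z : set (#|I|.-tuple (measurableTypeR R)) := [set t | mveval t p = 0].
have mZ : measurable Z by exact: mveval_zero_measurable.
exists (random_vector X @^-1` Z); split.
- rewrite -[X in measurable X]setTI; exact: measurable_funPT.
- transitivity (distribution P (random_vector X) Z); first by [].
  rewrite fE // null_set_integral //; last exact: mveval_null.
  by apply/measurable_EFinP; exact: measurable_funTS.
- by move=> w /= /negP; rewrite negbK => /eqP.
Qed.

(** The deterministic core: genericity enters through nonzero gains and one nonzero determinant. *)
Lemma DoF_le (R : realType) (K L T : nat) (g : 'I_K -> 'I_K -> 'I_L -> R)
    (i1 i2 i3 i4 : 'I_K) s (la : R) :
    uniq [:: i1; i2; i3; i4] -> (0 < L * T)%N -> 1 <= la -> s%:R <= la ->
    (forall i j l, g i j l != 0) ->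
    \det (loop_mx (fun l i j => g i j l) i1 i2 i3 i4 s) != 0 ->
  DoF (fun i j => channel_mx T (g i j)) <= K%:R / 2 * (1 - 2 ^- 17 / la).
Proof.
move=> i_uniq LT0 la1 sla g0 /(loop_mx_span g0) span.
have [[D [V [VD ->]]] _] := DoF_max (fun i j => channel_mx T (g i j)).
rewrite natrM -!mulrA ler_wpM2l //; apply: (dof_ratio_le LT0 _ la1 sla).
  have i12 : i2 != i1 by move: i_uniq; rewrite /= !inE !negb_or eq_sym => /andP[/andP[]].
  exact: (strategy_half g0 VD i12).
move=> ND; apply: (strategy_bound g0 VD i_uniq _ span ND) => j k.
exact: digit_le.
Qed.

Theorem theorem3 (R : realType) (d : measure_display)
  (Omega : measurableType d) (P : probability Omega R)
  (K L T : nat) (hK : (4 <= K)%N) (hL : (1 <= L)%N) (hT : (1 <= T)%N)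
  (h : 'I_K -> 'I_K -> 'I_L -> {RV P >-> R})
  (hdens : has_density (distribution P (random_vector
     (fun k : 'I_K * 'I_K * 'I_L => h k.1.1 k.1.2 k.2)))) :
  {ae P, forall w : Omega,
    DoF (fun i j => channel_mx T (fun l => h i j l w)) <=
    K%:R / 2 *
      (1 - 2 ^- 17 *
        Num.min (L%:R `^ (4^-1))^-1
                (2 `^ ((K%:R - 2) * (K%:R - 3) / 4) / Num.sqrt L%:R))}.
Proof.
set I := ('I_K * 'I_K * 'I_L)%type in hdens.
pose user k (k4 : (k < 4)%N) : 'I_K := Ordinal (leq_trans k4 hK).
set i1 := user 0%N isT; set i2 := user 1%N isT.
set i3 := user 2%N isT; set i4 := user 3%N isT.
have i_uniq : uniq [:: i1; i2; i3; i4] by rewrite -(map_inj_uniq val_inj).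
(* [s] is the integer part of the fourth root of [L]: small enough for the estimate, large enough to
   supply [L] monomials. *)
have [s [sL Ls]] : exists s, (s ^ 4 <= L /\ L <= s.+1 ^ 4)%N.
  have ex0 : exists s, (s ^ 4 <= L)%N by exists 0%N.
  have bound s : (s ^ 4 <= L -> s <= L)%N.
    by apply: leq_trans; rewrite -[X in (X <= _)%N]expn1; case: s => // s; exact: leq_pexp2l.
  case: (ex_maxnP ex0 bound) => s sL smax; exists s; split=> //.
  by rewrite leqNgt; apply/negP => /ltnW /smax; rewrite ltnn.
pose x (l : 'I_L) (i j : 'I_K) := mvvar R #|{: I}| (enum_rank (i, j, l)).
(* The product of all variables makes nonvanishing of [p] also give nonzero gains. *)
pose p := \det (loop_mx x i1 i2 i3 i4 s) * \prod_(k : I) mvvar R #|{: I}| (enum_rank k).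
have evalx t l i j : mveval t (x l i j) = tnth t (enum_rank (i, j, l)).
  exact: mveval_var.
have evalp t : mveval t p =
    \det (loop_mx (fun l i j => tnth t (enum_rank (i, j, l))) i1 i2 i3 i4 s) *
    \prod_(k : I) tnth t (enum_rank k).
  rewrite rmorphM rmorph_prod -det_map_mx map_loop_mx; congr (\det _ * _).
    by congr loop_mx; do 3!apply/funext => ?; rewrite evalx.
  by apply: eq_bigr => k _; rewrite mveval_var.
have p0 : p != 0.
  pose t := [tuple witness i1 i2 i3 i4 s (enum_val k).1.1 (enum_val k).1.2 (enum_val k).2
    | k < #|{: I}|] : #|{: I}|.-tuple R.
  have tE (k : I) : tnth t (enum_rank k) = witness i1 i2 i3 i4 s k.1.1 k.1.2 k.2.
    by rewrite tnth_mktuple enum_rankK.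
  apply/eqP => /(congr1 (mveval t)); rewrite evalp rmorph0; apply/eqP.
  rewrite mulf_neq0 //; last by apply/prodf_neq0 => k _; rewrite tE witness_neq0.
  rewrite (_ : (fun l i j => _) = (fun l i j => witness i1 i2 i3 i4 s i j l)).
    exact: det_loop_mx_witness.
  by do 3!apply/funext => ?; rewrite tE.
have := ae_mveval_neq0 hdens p0; apply: filterS => w.
have rvE (k : I) : tnth (random_vector (fun k : I => h k.1.1 k.1.2 k.2) w) (enum_rank k)
    = h k.1.1 k.1.2 k.2 w.
  by rewrite tnth_mktuple enum_rankK.
rewrite evalp mulf_eq0 negb_or => /andP[detw /prodf_neq0 hw].
have g0 i j l : h i j l w != 0 by have := hw (i, j, l) isT; rewrite rvE.
have la1 : 1 <= L%:R `^ (4^-1) :> R by apply: (@root4_ge R L 1); rewrite exp1n.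
have := @DoF_le R K L T (fun i j l => h i j l w) i1 i2 i3 i4 s _ i_uniq _ la1 (root4_ge R sL) g0.
rewrite muln_gt0 hL hT => /(_ isT).
rewrite (_ : loop_mx _ _ _ _ _ _ =
  loop_mx (fun l i j => tnth (random_vector (fun k : I => h k.1.1 k.1.2 k.2) w)
    (enum_rank (i, j, l))) i1 i2 i3 i4 s); last first.
  by congr loop_mx; do 3!apply/funext => ?; rewrite rvE.
move=> /(_ detw) /le_trans; apply; apply: ler_wpM2l; first by rewrite divr_ge0.
(* The minimum is at most its first term. *)
by rewrite lerD2l lerN2 ler_wpM2l ?invr_ge0 ?exprn_ge0 // ge_min lexx.
Qed.
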